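(* Let $I\subset R=\mathbb{K}[x_1,\ldots,x_n]$ be a monomial ideal generated by monomials $f_1,\ldots,f_m$, and let $d_i=\deg(f_i)$ for $i=1,\ldots,m$. Suppose that for each $i=2,\ldots,m$ the colon ideal $(f_1,\ldots,f_{i-1}):f_i$ is generated by an $(a_i,r_i)$-regular sequence. Set $a_1=r_1=0$. For $i\ge 0$ let $A_i=\{ia_p+d_p: p=1,\ldots,m\}$, and for $i,j\ge 0$ let $K^i_j=\{1\le k\le m: a_ki+d_k=j\}$. Then: (1) For all $i,j\ge0$, $$\beta_{i,j}(I)\le \begin{cases}\sum_{k\in K^i_j}\binom{r_k}{i}, & j\in A_i,\\ 0,& j\notin A_i.\end{cases}$$ (2) Equality holds in (1) for all $i,j\ge 0$ if the following condition holds: for all $k=2,\ldots,m$ and all $1\le i\le \max\{r_2,\ldots,r_k\}+1$, one has $$a_ki+d_k\notin\{a_\ell(i-1)+d_\ell : 1\le \ell\le k-1\}.$$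
   Context: $\mathbb{K}$ is a field and $R=\mathbb{K}[x_1,\ldots,x_n]$ is the standard graded polynomial ring; $\beta_{i,j}(M)=\dim_{\mathbb{K}}\mathrm{Tor}_i^R(M,\mathbb{K})_j$. An $(a,r)$-regular sequence (or $(a,r)$-sequence) is a regular sequence $u_1,\ldots,u_r$ of monomials in $R$ with $\deg(u_1)=\cdots=\deg(u_r)=a$; a sequence of (non-constant) monomials is regular if and only if the monomials have pairwise disjoint supports. Binomial coefficients $\binom{r}{i}$ are $0$ for $i>r$, and $\binom{0}{0}=1$. *)

(* Defs.v *)
From mathcomp Require Import all_boot all_order all_algebra.
From mathcomp Require Import mpoly.
From Stdlib Require Import ClassicalEpsilon.

Set Implicit Arguments.
Unset Strict Implicit.
Unset Printing Implicit Defensive.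

Import GRing.Theory.
Local Open Scope ring_scope.

Section Ideals.
Variable R : comNzRingType.

Definition ideal_gen (s : seq R) (p : R) : Prop :=
  exists c : 'I_(size s) -> R, p = \sum_(i < size s) c i * s`_i.

Definition colon (J : R -> Prop) (f : R) (p : R) : Prop := J (p * f).

Definition regular_seq (s : seq R) : Prop :=
  (forall i p, (i < size s)%N ->
     ideal_gen (take i s) (p * s`_i) -> ideal_gen (take i s) p)
  /\ ~ ideal_gen s 1.

End Ideals.

Section Betti.
Variables (K : fieldType) (n : nat).
Local Notation R := {mpoly K[n]}.

Definition monomials (s : seq 'X_{1..n}) : seq R := [seq 'X_[u] | u <- s].

Definition ar_sequence (a r : nat) (s : seq 'X_{1..n}) : Prop :=
  [/\ size s = r, all (fun u => mdeg u == a) s & regular_seq (monomials s)].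

(* The data of a sequence  ... -> F_1 -> F_0 -> R  in which F_i is free of
   finite rank with a basis whose k-th element has degree [gdeg i k], that is,
   F_i is the direct sum of the R(- gdeg i k).  Elements of F_i are row vectors
   and the maps act by multiplication on the right; [dif i] goes from F_{i+1}
   to F_i, and [aug] from F_0 to R. *)
Record graded_free_seq := GradedFreeSeq {
  rk : nat -> nat;
  gdeg : forall i, 'I_(rk i) -> nat;
  dif : forall i, 'M[R]_(rk i.+1, rk i);
  aug : 'cV[R]_(rk 0)
}.

(* The first two clauses say that the maps are homogeneous of degree 0. *)
Record graded_free_resolution (I : R -> Prop) (F : graded_free_seq) : Prop := {
  dif_homog : forall i k l (u : 'X_{1..n}),
    u \in msupp (dif F i k l) -> (mdeg u + gdeg l = gdeg k)%N;
  aug_homog : forall k (u : 'X_{1..n}),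
    u \in msupp (aug F k ord0) -> mdeg u = gdeg k;
  aug_image : forall p : R, I p <-> exists v : 'rV_(rk F 0), v *m aug F = p%:M;
  aug_exact : forall v : 'rV_(rk F 0),
    v *m aug F = 0 <-> exists w, v = w *m dif F 0;
  dif_exact : forall i (v : 'rV_(rk F i.+1)),
    v *m dif F i = 0 <-> exists w, v = w *m dif F i.+1
}.

(* F_i (x)_R K is K^(rk i), and since K = R/(x_1, ..., x_n) the induced
   differential is obtained by taking constant coefficients. *)
Definition difK (F : graded_free_seq) i : 'M[K]_(rk F i.+1, rk F i) :=
  map_mx (mcoeff 0%MM) (dif F i).

Definition cyclesK (F : graded_free_seq) i : 'M[K]_(rk F i) :=
  match i with
  | 0 => 1%:M
  | i'.+1 => kermx (difK F i')
  end.

(* Its row space is the degree j component of F_i (x)_R K. *)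
Definition strandK (F : graded_free_seq) i j : 'M[K]_(rk F i) :=
  diag_mx (\row_k (gdeg k == j)%:R).

(* The dimension of H_i(F (x)_R K)_j, as cycles minus boundaries. *)
Definition tor_dim (F : graded_free_seq) i j : nat :=
  (\rank (strandK F i j :&: cyclesK F i)%MS
   - \rank (strandK F i.+1 j *m difK F i))%N.

Definition trivial_seq : graded_free_seq :=
  @GradedFreeSeq (fun=> 0%N) (fun _ _ => 0%N) (fun=> 0) 0.

(* beta_{i,j}(I) = dim_K Tor_i^R(I, K)_j, with Tor computed from a graded free
   resolution of I.  By Hilbert's basis theorem every homogeneous ideal has one
   with finite ranks, so the default [trivial_seq] is irrelevant for these. *)
Definition betti (I : R -> Prop) (i j : nat) : nat :=
  tor_dim (epsilon (inhabits trivial_seq) (graded_free_resolution I)) i j.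

End Betti.

Definition Aset (m : nat) (a d : nat -> nat) (i : nat) : seq nat :=
  [seq (i * a p + d p)%N | p <- iota 1 m].

Definition Kset (m : nat) (a d : nat -> nat) (i j : nat) : seq nat :=
  [seq k <- iota 1 m | (a k * i + d k == j)%N].

Definition betti_bound (m : nat) (a d r : nat -> nat) (i j : nat) : nat :=
  if j \in Aset m a d i then \sum_(k <- Kset m a d i j) 'C(r k, i) else 0%N.

(* Main.v *)
Require Import Defs.
From mathcomp Require Import all_boot all_order all_algebra.
From mathcomp Require Import mpoly.
From Stdlib Require Import ClassicalEpsilon.

(** Write J_k for (f_1, ..., f_k).  The exact sequence
      0 -> R/(J_{k-1} : f_k) (- d_k) -> R/J_{k-1} -> R/J_k -> 0,
    whose first map is multiplication by f_k, presents R/J_k as a cokernel, so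
    the mapping cone of a lift of that map to resolutions resolves R/J_k.  The
    colon ideal is generated by a regular sequence of r_k forms of degree a_k
    and is therefore resolved by a Koszul complex, whose i-th module is free of
    rank C(r_k, i) on generators of degree a_k i.  After the shift by d_k, the
    k-th cone adds to the i-th module of the resolution of J_{k-1} exactly
    C(r_k, i) generators of degree a_k i + d_k ([iterated_cone]).  Hence the
    bound is the number of generators of degree j in homological degree i of
    one particular resolution of I, and a Betti number never exceeds this
    number ([tor_dim_le_count]).

    Equality holds as soon as that resolution is minimal, that is, its maps
    have no constant terms ([tor_dim_minimal]).  The maps are homogeneous of
    degree 0, so a constant entry can only join two generators of equal degree.
    Within the k-th Koszul block the degrees a_k i + d_k and a_k (i-1) + d_k
    differ since a_k > 0; a map out of the k-th block into the resolution of
    J_{k-1} lands in degrees a_l (i-1) + d_l with l < k, which the condition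
    of the second part excludes; and the cone has no map out of the
    resolution of J_{k-1} into the k-th block.

    The Koszul complex needs no separate construction: it is itself an
    iterated cone, because a regular sequence u_1, ..., u_r satisfies
    (u_1, ..., u_t) : u_{t+1} = (u_1, ..., u_t), so each step is the cone of a
    lift of multiplication by u_{t+1} from a resolution to itself
    ([koszul_resolution]).

    The Betti numbers are read off an arbitrary resolution of I, so the
    argument also requires that the dimensions of the strands of
    F (x) K depend on I alone ([tor_dim_le]).  This is the comparison theorem:
    the identity of I lifts to chain maps F -> G -> F whose composite is
    homotopic to the identity.  The lift F -> G must be homogeneous to respect
    strands; an arbitrary lift is made so by keeping, in each entry, only the
    terms of the right degree ([homog_part_mul]). *)

Set Implicit Arguments.
Unset Strict Implicit.
Unset Printing Implicit Defensive.

(** * Ideals generated by a sequence *)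

Section IdealGen.
Import GRing.Theory.
Local Open Scope ring_scope.
Variable R : comNzRingType.
Implicit Types (s : seq R) (p q x : R).

(** Coefficients indexed by all natural numbers can be reused when the
    sequence grows. *)
Lemma ideal_genP s p :
  ideal_gen s p <-> exists c : nat -> R, p = \sum_(i < size s) c i * s`_i.
Proof.
split=> -[c ->]; last by exists (fun i => c i).
exists (fun i => oapp c 0 (insub i)); apply: eq_bigr => i _.
by rewrite valK.
Qed.

Lemma ideal_gen_nil p : ideal_gen [::] p <-> p = 0.
Proof.
rewrite ideal_genP; split=> [[c ->]|->]; first by rewrite big_ord0.
by exists (fun=> 0); rewrite big_ord0.
Qed.

Lemma ideal_gen_rcons s x p :
  ideal_gen (rcons s x) p <-> exists q, ideal_gen s (p - q * x).
Proof.
split=> [/ideal_genP[c ->]|[q /ideal_genP[c pE]]].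
  exists (c (size s)); apply/ideal_genP; exists c.
  rewrite size_rcons big_ord_recr /= nth_rcons ltnn eqxx addrK.
  by apply: eq_bigr => i _; rewrite nth_rcons ltn_ord.
apply/ideal_genP; exists (fun i => if i == size s then q else c i).
rewrite size_rcons big_ord_recr /= nth_rcons ltnn eqxx.
rewrite -[LHS](subrK (q * x)) pE; congr (_ + _); apply: eq_bigr => i _.
by rewrite nth_rcons ltn_ord ltn_eqF.
Qed.

Lemma ideal_genMr s p q : ideal_gen s p -> ideal_gen s (p * q).
Proof.
move=> [c ->]; exists (fun i => c i * q); rewrite mulr_suml.
by apply: eq_bigr => i _; rewrite mulrAC.
Qed.

Lemma mem_ideal_gen s i : (i < size s)%N -> ideal_gen s s`_i.
Proof.
move=> lt_i; exists (fun k => (k == Ordinal lt_i)%:R).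
rewrite (bigD1 (Ordinal lt_i)) //= eqxx mul1r big1 ?addr0 // => k /negbTE->.
by rewrite mul0r.
Qed.

End IdealGen.

(** Chain maps and homotopies are built degree by degree, each component
    depending on the previous one.  [Q] is the invariant that allows the next
    step, [S] the relation between consecutive components. *)
Lemma dependent_choice (T : nat -> Type) (Q : forall i, T i -> Prop)
    (S : forall i, T i -> T i.+1 -> Prop) (x0 : T 0) :
    Q 0%N x0 -> (forall i x, Q i x -> exists y, Q i.+1 y /\ S i x y) ->
  exists2 x : forall i, T i,
    x 0 = x0 & forall i, Q i (x i) /\ S i (x i) (x i.+1).
Proof.
move=> Qx0 step.
pose next i (x : {x : T i | Q i x}) :=
  constructive_indefinite_description _ (step i (sval x) (proj2_sig x)).
pose fix seqx i : {x : T i | Q i x} :=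
  match i with
  | 0 => exist _ x0 Qx0
  | i'.+1 => let y := next i' (seqx i') in
             exist _ (sval y) (proj1 (proj2_sig y))
  end.
exists (fun i => sval (seqx i)) => // i.
split; first exact: (proj2_sig (seqx i)).
exact: (proj2 (proj2_sig (next i (seqx i)))).
Qed.

(** * Homogeneous matrices and lifting along exact maps *)

Section Homogeneous.
Import GRing.Theory.
Local Open Scope ring_scope.
Variables (K : fieldType) (n : nat).
Local Notation R := {mpoly K[n]}.

(** [A] is a map of degree 0 between graded free modules whose bases have
    degrees [g] and [h]. *)
Definition homog_mx p q (g : 'I_p -> nat) (h : 'I_q -> nat)
    (A : 'M[R]_(p, q)) :=
  forall k l (u : 'X_{1..n}), u \in msupp (A k l) -> (mdeg u + h l = g k)%N.

Definition homog_part p q (g : 'I_p -> nat) (h : 'I_q -> nat)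
    (A : 'M[R]_(p, q)) : 'M[R]_(p, q) :=
  \matrix_(k, l) \sum_(u <- msupp (A k l) | (mdeg u + h l == g k)%N)
     (A k l)@_u *: 'X_[u].

Lemma mcoeff_homog_part p q g h (A : 'M[R]_(p, q)) k l u :
  (homog_part g h A k l)@_u = (A k l)@_u *+ (mdeg u + h l == g k)%N.
Proof.
rewrite mxE raddf_sum /=.
rewrite (eq_bigr (fun v => (A k l)@_v * (v == u)%:R)); last first.
  by move=> v _; rewrite mcoeffZ mcoeffX.
case: (boolP (u \in msupp (A k l))) => uA; last first.
  rewrite (memN_msupp_eq0 uA) mul0rn big_seq_cond big1 // => v /andP[vA _].
  by case: eqP vA uA => [->->|] //; rewrite mulr0.
rewrite big_mkcond (bigD1_seq u) ?msupp_uniq //= eqxx mulr1 big1 ?addr0.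
  by case: ifP.
by move=> v /negbTE->; rewrite mulr0 if_same.
Qed.

Lemma homog_part_homog p q g h (A : 'M[R]_(p, q)) :
  homog_mx g h (homog_part g h A).
Proof.
move=> k l u; rewrite mcoeff_msupp mcoeff_homog_part.
by case: (@eqP _ _ (g k)) => // _; rewrite mulr0n eqxx.
Qed.

Lemma homog_part_id p q g h (A : 'M[R]_(p, q)) :
  homog_mx g h A -> homog_part g h A = A.
Proof.
move=> hA; apply/matrixP => k l; apply/mpolyP => u; rewrite mcoeff_homog_part.
case: (boolP (u \in msupp (A k l))) => [/hA->|/memN_msupp_eq0->].
  by rewrite eqxx.
by rewrite mul0rn.
Qed.

(** Only products of terms whose degrees add up to the right value contribute
    to the degree-0 part, and those of [B] all have the right degree.  Hence
    the degree-0 part of a lift is again a lift. *)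
Lemma homog_part_mul p q s g h e (A : 'M[R]_(p, q)) (B : 'M[R]_(q, s)) :
  homog_mx h e B -> homog_part g e (A *m B) = homog_part g h A *m B.
Proof.
move=> hB; apply/matrixP => k l; apply/mpolyP => u.
rewrite mcoeff_homog_part !mxE !raddf_sum /= -sumrMnl; apply: eq_bigr => t _.
rewrite !mcoeffM -sumrMnl; apply: eq_bigr => -[v w] /= /eqP uE.
have -> : (mdeg u + e l = mdeg v + (mdeg w + e l))%N.
  by rewrite {1}uE mdegD addnA.
rewrite mcoeff_homog_part.
case: (boolP (bmnm w \in msupp (B t l))) => [/hB <-|/memN_msupp_eq0->].
  by rewrite mulrnAl.
by rewrite !mulr0 mul0rn.
Qed.

Lemma homog_mxM p q s g h e (A : 'M[R]_(p, q)) (B : 'M[R]_(q, s)) :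
  homog_mx g h A -> homog_mx h e B -> homog_mx g e (A *m B).
Proof.
move=> hA hB; rewrite -(homog_part_id hA) -(homog_part_mul _ _ hB).
exact: homog_part_homog.
Qed.

Lemma homog_factor p q s g h e (A : 'M[R]_(p, s)) (W : 'M[R]_(p, q))
    (D : 'M[R]_(q, s)) :
    homog_mx g e A -> homog_mx h e D -> A = W *m D ->
  exists2 W', homog_mx g h W' & W' *m D = A.
Proof.
move=> hA hD AE; exists (homog_part g h W); first exact: homog_part_homog.
by rewrite -(homog_part_mul _ _ hD) -AE homog_part_id.
Qed.

Lemma factor_rows p q s (A : 'M[R]_(p, s)) (D : 'M[R]_(q, s)) :
  (forall k, exists w, row k A = w *m D) -> exists W, A = W *m D.
Proof.
move=> /fin_all_exists[w wE]; exists (\matrix_k w k).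
by apply/row_matrixP => k; rewrite row_mul rowK.
Qed.

(** A map from a free module into a kernel lifts along a map onto that
    kernel. *)
Lemma factor_exact p q s t (A : 'M[R]_(p, s)) (B : 'M[R]_(s, t))
    (D : 'M[R]_(q, s)) :
    (forall v : 'rV_s, v *m B = 0 <-> exists w, v = w *m D) ->
  A *m B = 0 -> exists W, A = W *m D.
Proof.
move=> exBD AB0; apply: factor_rows => k; apply/exBD.
by rewrite -row_mul AB0 row0.
Qed.

Lemma exact_comp0 q s t (B : 'M[R]_(s, t)) (D : 'M[R]_(q, s)) :
    (forall v : 'rV_s, v *m B = 0 <-> exists w, v = w *m D) ->
  D *m B = 0.
Proof.
move=> exBD; apply/row_matrixP => k; rewrite row_mul row0; apply/exBD.
by exists (delta_mx 0 k); rewrite rowE.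
Qed.

(** The matrix of the map induced after tensoring with K = R/(x_1, ..., x_n). *)
Definition residue p q (A : 'M[R]_(p, q)) : 'M[K]_(p, q) :=
  map_mx (mcoeff 0%MM) A.

Lemma residue_eq0 p q g h (A : 'M[R]_(p, q)) :
  homog_mx g h A -> (forall k l, g k != h l) -> residue A = 0.
Proof.
move=> hA gh; apply/matrixP => k l; rewrite !mxE; apply: memN_msupp_eq0.
by apply/negP => /hA; rewrite mdeg0 add0n => E; move: (gh k l); rewrite E eqxx.
Qed.

(** A constant entry of a homogeneous map joins basis elements of equal
    degree, so tensoring with K gives a map that respects strands. *)
Lemma residue_strand p q g h (A : 'M[R]_(p, q)) j : homog_mx g h A ->
  diag_mx (\row_k (g k == j)%:R) *m residue A =
  residue A *m diag_mx (\row_l (h l == j)%:R).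
Proof.
move=> hA; rewrite mul_diag_mx mul_mx_diag; apply/matrixP => k l; rewrite !mxE.
case: (boolP (0%MM \in msupp (A k l))) => [/hA|/memN_msupp_eq0->].
  by rewrite mdeg0 add0n => ->; rewrite mulrC.
by rewrite mul0r mulr0.
Qed.

End Homogeneous.

(** * The comparison theorem *)

Section Comparison.
Import GRing.Theory.
Local Open Scope ring_scope.
Variables (K : fieldType) (n : nat).
Local Notation R := {mpoly K[n]}.
Implicit Types (F G H : graded_free_seq K n) (I J L : R -> Prop).

Lemma aug_row H L k : graded_free_resolution L H -> L (aug H k 0).
Proof.
move=> resH; apply/(aug_image resH); exists (delta_mx 0 k).
by rewrite -rowE; apply/rowP => j; rewrite !mxE !ord1 eqxx.
Qed.

Lemma dif_dif I F i :
  graded_free_resolution I F -> dif F i.+1 *m dif F i = 0.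
Proof. by move=> resF; apply: (exact_comp0 (@dif_exact _ _ _ _ resF _)). Qed.

Lemma dif_aug I F : graded_free_resolution I F -> dif F 0 *m aug F = 0.
Proof. by move=> resF; apply: (exact_comp0 (aug_exact resF)). Qed.

(** Multiplication by [f] from [L] to [J] lifts to a chain map of degree [d]
    between resolutions.  The case [f = 1] compares two resolutions of the same
    ideal; for [L] a colon ideal [J : f], the lift is the map of which the cone
    is taken. *)
Lemma comparison F H L J (f : R) d :
    graded_free_resolution L H -> graded_free_resolution J F ->
    (forall p, L p -> J (p * f)) -> (forall u, u \in msupp f -> mdeg u = d) ->
  exists phi : forall i, 'M[R]_(rk H i, rk F i),
    [/\ forall i, homog_mx (fun k => gdeg k + d)%N (@gdeg _ _ F i) (phi i),
        phi 0%N *m aug F = aug H *m f%:M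
      & forall i, phi i.+1 *m dif F i = dif H i *m phi i].
Proof.
move=> resH resF LJ hf.
have hdF i : homog_mx (@gdeg _ _ F i.+1) (@gdeg _ _ F i) (dif F i).
  exact: (@dif_homog _ _ _ _ resF).
have hdH i : homog_mx (fun k => gdeg k + d)%N (fun k => gdeg k + d)%N (dif H i).
  by move=> k l u /(dif_homog resH) <-; rewrite addnA.
have haF : homog_mx (@gdeg _ _ F 0) (fun=> 0%N) (aug F).
  by move=> k l u; rewrite ord1 addn0 => /(aug_homog resF).
have haH : homog_mx (fun k => @gdeg _ _ H 0 k + d)%N (fun=> d) (aug H).
  by move=> k l u; rewrite ord1 => /(aug_homog resH) ->.
have hf1 : homog_mx (fun _ : 'I_1 => d) (fun _ : 'I_1 => 0%N) f%:M.
  by move=> k l u; rewrite !ord1 mxE eqxx mulr1n addn0 => /hf.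
have [W0 W0E] : exists W, aug H *m f%:M = W *m aug F.
  apply: factor_rows => k; have /LJ/(aug_image resF)[v vE] := aug_row k resH.
  exists v; rewrite vE; apply/rowP => j.
  by rewrite !mxE big_ord1 !mxE !ord1 eqxx !mulr1n.
have [phi0 hphi0 phi0E] := homog_factor (homog_mxM haH hf1) haF W0E.
(* The second clause says that the next component exists: the image of
   [dif H i *m x] consists of boundaries. *)
pose Q i (x : 'M[R]_(rk H i, rk F i)) :=
  homog_mx (fun k => gdeg k + d)%N (@gdeg _ _ F i) x /\
  exists W, dif H i *m x = W *m dif F i.
have Q0 : Q 0%N phi0.
  split=> //; apply: (factor_exact (aug_exact resF)) _.
  by rewrite -mulmxA phi0E mulmxA (dif_aug resH) mul0mx.
case: (dependent_choice (Q := Q)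
  (S := fun i x y => y *m dif F i = dif H i *m x) Q0) => [i x [hx [W WE]]|].
  have [y hy yE] := homog_factor (homog_mxM (hdH i) hx) (hdF i) WE.
  exists y; split=> //; split=> //.
  apply: (factor_exact (@dif_exact _ _ _ _ resF _)) _.
  by rewrite -mulmxA yE mulmxA (dif_dif _ resH) mul0mx.
move=> phi phi_0 phiP; exists phi; split; last 1 first.
- by move=> i; case: (phiP i).
- by move=> i; case: (phiP i) => -[].
- by rewrite phi_0.
Qed.

(** A chain endomorphism that lifts the zero map is null-homotopic: what the
    part of the homotopy built so far leaves of [theta i.+1] consists of
    cycles, which exactness turns into boundaries. *)
Lemma homotopy F J (theta : forall i, 'M[R]_(rk F i)) :
    graded_free_resolution J F ->
    theta 0%N *m aug F = 0 ->
    (forall i, theta i.+1 *m dif F i = dif F i *m theta i) ->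
  exists2 h : forall i, 'M[R]_(rk F i, rk F i.+1),
    theta 0%N = h 0%N *m dif F 0 &
    forall i, theta i.+1 = h i.+1 *m dif F i.+1 + dif F i *m h i.
Proof.
move=> resF th0 thS.
have [h0 h0E] := factor_exact (aug_exact resF) th0.
pose Q i (x : 'M[R]_(rk F i, rk F i.+1)) :=
  exists W, theta i.+1 - dif F i *m x = W *m dif F i.+1.
have Q0 : Q 0%N h0.
  apply: (factor_exact (@dif_exact _ _ _ _ resF _)) _.
  by rewrite mulmxBl thS -mulmxA -h0E subrr.
case: (dependent_choice (Q := Q)
  (S := fun i x y => theta i.+1 = y *m dif F i.+1 + dif F i *m x) Q0)
    => [i x [W WE]|h h_0 hP].
  exists W; split; last by rewrite -WE subrK.
  apply: (factor_exact (@dif_exact _ _ _ _ resF _)) _.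
  rewrite mulmxBl thS -mulmxA -mulmxBr -WE opprB addrC subrK mulmxA.
  by rewrite (dif_dif _ resF) mul0mx.
by exists h => [|i]; [rewrite h_0 | case: (hP i)].
Qed.

End Comparison.

(** * Independence of the resolution *)

Section Homology.
Import GRing.Theory.
Local Open Scope ring_scope.
Variables (K : fieldType).

(** The hypotheses on [phi] say that it induces an injective map from Z/B to
    Z'/B'.  The quotient by [B'] is modelled by multiplication by
    [cokermx B']. *)
Lemma homology_rank_le m1 m2 m3 m4 p q (Z : 'M[K]_(m1, p)) (B : 'M[K]_(m2, p))
    (Z' : 'M[K]_(m3, q)) (B' : 'M[K]_(m4, q)) (phi : 'M[K]_(p, q)) :
    (B' <= Z')%MS -> (Z *m phi <= Z')%MS ->
    (forall u : 'M_p, u <= Z -> u *m phi <= B' -> u <= B)%MS ->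
  (\rank Z - \rank B <= \rank Z' - \rank B')%N.
Proof.
move=> BZ' Zphi inj.
have := mxrank_mul_ker Z (phi *m cokermx B').
have := mxrank_mul_ker Z' (cokermx B').
set r1 := \rank (Z' *m _); set r2 := \rank (Z' :&: _)%MS.
set s1 := \rank (Z *m _); set s2 := \rank (Z :&: _)%MS => E1 E2.
have r2E : (\rank B' <= r2)%N.
  apply: mxrankS; rewrite sub_capmx BZ'.
  by apply/sub_kermxP/eqP; rewrite -submxE.
have s1r1 : (s1 <= r1)%N by rewrite /s1 mulmxA; apply/mxrankS/submxMr.
have s2E : (s2 <= \rank B)%N.
  apply/mxrankS/inj; first exact: capmxSl.
  by rewrite submxE -mulmxA; apply/eqP/sub_kermxP; exact: capmxSr.
rewrite -E2 -E1 leq_subLR; apply: leq_trans (leq_add s1r1 s2E) _.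
by rewrite addnC leq_add2l -addnBA // leq_addr.
Qed.

(** Each rank is at most the number of nonzero diagonal entries; equality
    follows because this matrix and the one of the complementary predicate add
    up to the identity. *)
Lemma rank_diag_bool m (P : pred 'I_m) :
  \rank (diag_mx (\row_k ((P k)%:R : K))) = (\sum_k P k)%N.
Proof.
have le (Q : pred 'I_m) :
    (\rank (diag_mx (\row_k ((Q k)%:R : K))) <= \sum_k Q k)%N.
  rewrite diag_mx_sum_delta.
  elim/big_ind2: _ => [|M x N y hM hN|k _]; first by rewrite mxrank0.
    exact: leq_trans (mxrank_add M N) (leq_add hM hN).
  rewrite mxE; case: (Q k); first by rewrite scale1r mxrank_delta.
  by rewrite scale0r mxrank0.
apply/eqP; rewrite eqn_leq le /=.
have E : (\sum_k P k + \sum_k ~~ P k = m)%N.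
  rewrite -big_split -[RHS](card_ord m) -sum1_card; apply: eq_bigr => k _ /=.
  by case: (P k).
rewrite -(leq_add2r (\sum_k ~~ P k)) E -[X in (X <= _)%N](mxrank1 K m).
apply: leq_trans (leq_add (leqnn _) (le (predC P))).
apply: leq_trans (mxrank_add _ _); apply: eq_leq; congr (\rank _).
apply/matrixP => k l; rewrite !mxE /=; case: eqP => // _.
  by case: (P k); rewrite ?addr0 ?add0r.
by rewrite addr0.
Qed.

End Homology.

Section TorInvariance.
Import GRing.Theory.
Local Open Scope ring_scope.
Variables (K : fieldType) (n : nat).
Local Notation R := {mpoly K[n]}.
Implicit Types (F G H : graded_free_seq K n) (I J L : R -> Prop).

Lemma strandK_id F i j : strandK F i j *m strandK F i j = strandK F i j.
Proof.
rewrite /strandK mul_diag_mx; apply/matrixP => k l; rewrite !mxE.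
by case: (k == l); case: (gdeg k == j); rewrite ?mul1r ?mul0r ?mulr0.
Qed.

Lemma sub_strandK F i j m (u : 'M_(m, _)) :
  (u <= strandK F i j)%MS -> u *m strandK F i j = u.
Proof. by move=> /submxP[x ->]; rewrite -mulmxA strandK_id. Qed.

(** The composite of comparison maps F -> G -> F is homotopic to the identity,
    so a cycle of F (x) K whose image in G (x) K is a boundary was already a
    boundary: F -> G is injective on homology. *)
Lemma tor_dim_le I F G i j :
    graded_free_resolution I F -> graded_free_resolution I G ->
  (tor_dim F i j <= tor_dim G i j)%N.
Proof.
move=> resF resG.
have id1 (p : R) : I p -> I (p * 1) by rewrite mulr1.
have h1 (u : 'X_{1..n}) : u \in msupp (1 : R) -> mdeg u = 0%N.
  by rewrite -mpolyX0 msuppX inE => /eqP->; rewrite mdeg0.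
have [phi [hphi phi0 phiS]] := comparison resF resG id1 h1.
have [psi [_ psi0 psiS]] := comparison resG resF id1 h1.
have hdF k : homog_mx (@gdeg _ _ F k.+1) (@gdeg _ _ F k) (dif F k).
  exact: (@dif_homog _ _ _ _ resF).
have hdG k : homog_mx (@gdeg _ _ G k.+1) (@gdeg _ _ G k) (dif G k).
  exact: (@dif_homog _ _ _ _ resG).
have [||h hh0 hhS] := homotopy (theta := fun k => 1%:M - phi k *m psi k) resF.
- by rewrite mulmxBl mul1mx -mulmxA psi0 mulmxA phi0 !mulmx1 subrr.
- by move=> k; rewrite mulmxBl mulmxBr mul1mx mulmx1 -mulmxA psiS !mulmxA phiS.
have phi_strand k :
    strandK F k j *m residue (phi k) = residue (phi k) *m strandK G k j.
  by apply: residue_strand => a b u /hphi; rewrite addn0.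
have F_strand k : strandK F k.+1 j *m difK F k = difK F k *m strandK F k j.
  exact: residue_strand (hdF k).
have G_strand k : strandK G k.+1 j *m difK G k = difK G k *m strandK G k j.
  exact: residue_strand (hdG k).
have phiK k : residue (phi k.+1) *m difK G k = difK F k *m residue (phi k).
  by rewrite -!map_mxM phiS.
have psiK k : residue (psi k.+1) *m difK F k = difK G k *m residue (psi k).
  by rewrite -!map_mxM psiS.
apply: (homology_rank_le (phi := residue (phi i))).
- rewrite sub_capmx G_strand submxMl /=.
  case: i => [|i] /=; first exact: submx1.
  apply/sub_kermxP; rewrite -G_strand -mulmxA -map_mxM.
  by rewrite (dif_dif _ resG) raddf0 mulmx0.
- rewrite sub_capmx; apply/andP; split.
    apply: submx_trans (submxMr _ (capmxSl _ _)) _.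
    by rewrite phi_strand submxMl.
  apply: submx_trans (submxMr _ (capmxSr _ _)) _.
  case: i => [|i] /=; first exact: submx1.
  by apply/sub_kermxP; rewrite -mulmxA phiK mulmxA mulmx_ker mul0mx.
move=> u; rewrite sub_capmx => /andP[/sub_strandK uS uZ] /submxP[y yE].
(* The homotopy, applied to the cycle [u], writes it as its image under the
   round trip plus a boundary. *)
have [w wE] : exists w,
    u = u *m residue (phi i) *m residue (psi i) + w *m difK F i.
  rewrite -mulmxA -map_mxM.
  exists (u *m residue (h i)).
  have -> : u *m residue (h i) *m difK F i =
      u *m residue (1%:M - phi i *m psi i).
    rewrite -mulmxA -map_mxM.
    case: i u uZ {yE y uS} => [|i] u uZ /=; first by rewrite hh0.
    rewrite hhS /residue map_mxD mulmxDr.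
    rewrite [X in _ = _ + u *m X]map_mxM (mulmxA u).
    by move/sub_kermxP: uZ => ->; rewrite mul0mx addr0.
  rewrite -mulmxDr /residue -map_mxD addrC subrK.
  by rewrite map_scalar_mx /= mcoeff1 eqxx mulmx1.
(* Multiplying by the strand projection turns this boundary into a boundary of
   an element of the strand. *)
rewrite -uS wE yE -!mulmxA -psiK !mulmxA -!mulmxDl -mulmxA -F_strand.
by rewrite submxMl.
Qed.

Lemma betti_tor_dim I F i j :
  graded_free_resolution I F -> betti I i j = tor_dim F i j.
Proof.
move=> resF; rewrite /betti.
have := epsilon_spec (inhabits (trivial_seq K n)) _ (ex_intro _ F resF).
set E := epsilon _ _ => resE; apply/eqP.
by rewrite eqn_leq (tor_dim_le i j resE resF) (tor_dim_le i j resF resE).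
Qed.

Definition deg_count F i j := (\sum_(k < rk F i) (gdeg k == j))%N.

Lemma tor_dim_le_count F i j : (tor_dim F i j <= deg_count F i j)%N.
Proof.
rewrite /deg_count -(rank_diag_bool K (fun k => gdeg k == j)).
exact: leq_trans (leq_subr _ _) (mxrankS (capmxSl _ _)).
Qed.

(** When the maps vanish modulo the maximal ideal, all of F (x) K consists of
    cycles and there are no nonzero boundaries. *)
Lemma tor_dim_minimal F i j :
  (forall i, difK F i = 0) -> tor_dim F i j = deg_count F i j.
Proof.
move=> dF0; rewrite /tor_dim dF0 mulmx0 mxrank0 subn0.
have Z1 : (1%:M <= cyclesK F i)%MS.
  by case: i => [|i] /=; [exact: submx1 | apply/sub_kermxP; rewrite dF0 mulmx0].
rewrite /deg_count -(rank_diag_bool K (fun k => gdeg k == j)); apply/eqP.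
rewrite eqn_leq (mxrankS (capmxSl _ _)) mxrankS //.
by rewrite sub_capmx submx_refl (submx_trans (submx1 _) Z1).
Qed.

End TorInvariance.

(** * Mapping cones *)

Section MappingCone.
Import GRing.Theory.
Local Open Scope ring_scope.
Variables (K : fieldType) (n : nat).
Local Notation R := {mpoly K[n]}.
Implicit Types (F G H : graded_free_seq K n) (I J L : R -> Prop).

Definition block_deg p q (g : 'I_p -> nat) (h : 'I_q -> nat)
    (k : 'I_(p + q)) : nat :=
  match split k with inl k1 => g k1 | inr k2 => h k2 end.

Lemma homog_block p1 p2 q1 q2 (g1 : 'I_p1 -> nat) (g2 : 'I_p2 -> nat)
    (h1 : 'I_q1 -> nat) (h2 : 'I_q2 -> nat)
    (A : 'M[R]_(p1, q1)) (B : 'M[R]_(p1, q2))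
    (C : 'M[R]_(p2, q1)) (D : 'M[R]_(p2, q2)) :
    homog_mx g1 h1 A -> homog_mx g1 h2 B ->
    homog_mx g2 h1 C -> homog_mx g2 h2 D ->
  homog_mx (block_deg g1 g2) (block_deg h1 h2) (block_mx A B C D).
Proof.
move=> hA hB hC hD k l u; rewrite /block_deg !mxE.
case: (split k) => k'; rewrite !mxE; case: (split l) => l'.
- exact: hA.
- exact: hB.
- exact: hC.
exact: hD.
Qed.

Lemma homog_mx0 p q (g : 'I_p -> nat) (h : 'I_q -> nat) :
  homog_mx g h (0 : 'M[R]_(p, q)).
Proof. by move=> k l u; rewrite mxE msupp0 in_nil. Qed.

Lemma homog_mxN p q (g : 'I_p -> nat) (h : 'I_q -> nat) (A : 'M[R]_(p, q)) :
  homog_mx g h A -> homog_mx g h (- A).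
Proof. by move=> hA k l u; rewrite mxE (perm_mem (msuppN _)); apply: hA. Qed.

(** If [H] resolves [L], the data [quot_rk], [quot_deg], [quot_dif] describe
    the resolution of R/L (- d): it is [H] shifted by one place, preceded by a
    free module of rank one. *)
Definition quot_rk H i : nat := match i with 0 => 1 | i'.+1 => rk H i' end.

Definition quot_deg H d i : 'I_(quot_rk H i) -> nat :=
  match i with
  | 0 => fun=> d
  | i'.+1 => fun k => (@gdeg _ _ H i' k + d)%N
  end.

Definition quot_dif H i : 'M[R]_(quot_rk H i.+1, quot_rk H i) :=
  match i with 0 => aug H | i'.+1 => dif H i' end.

(** The cone of [phi], truncated so as to resolve an ideal instead of a
    quotient ring.  The component [phi i] goes from place [i.+1] of the
    resolution of R/L to place [i] of [F]; the sign on [quot_dif] makes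
    consecutive maps compose to zero. *)
Definition cone F H (f : R) d (phi : forall i, 'M[R]_(rk H i, rk F i)) :
    graded_free_seq K n :=
  @GradedFreeSeq K n (fun i => rk F i + quot_rk H i)%N
    (fun i => block_deg (@gdeg _ _ F i) (@quot_deg H d i))
    (fun i => block_mx (dif F i) 0
                       (phi i : 'M_(quot_rk H i.+1, _)) (- quot_dif H i))
    (col_mx (aug F) (f%:M : 'M_(quot_rk H 0, 1))).

(** Exactness is a diagram chase.  A cycle [(v, w)] of the cone has [w] a cycle
    of the resolution of R/L, so [w] is a boundary, coming from some [x];
    subtracting the image of [x] leaves a cycle of [F], which is a boundary.
    At place 0 the chase starts from [w * f] in [J], which puts [w] in
    [L = J : f]. *)
Lemma cone_resolution F H I J L (f : R) d phi :
    graded_free_resolution J F -> graded_free_resolution L H ->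
    (forall p, L p <-> J (p * f)) ->
    (forall p, I p <-> exists q, J (p - q * f)) ->
    (forall u, u \in msupp f -> mdeg u = d) ->
    (forall i, homog_mx (fun k => gdeg k + d)%N (@gdeg _ _ F i) (phi i)) ->
    phi 0%N *m aug F = aug H *m f%:M ->
    (forall i, phi i.+1 *m dif F i = dif H i *m phi i) ->
  graded_free_resolution I (cone f d phi).
Proof.
move=> resF resH LJ IJ hf hphi phi0 phiS.
have quot_exact i (w : 'rV_(rk H i)) :
    w *m quot_dif H i = 0 -> exists x, w = x *m dif H i.
  case: i w => [|i] w /=; first by move/(aug_exact resH).
  by move/(dif_exact resH).
have quot_dd i : dif H i *m quot_dif H i = 0.
  by case: i => [|i]; [apply: dif_aug resH | apply: dif_dif resH].
split.
- move=> i; apply: homog_block.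
  + exact: (@dif_homog _ _ _ _ resF).
  + exact: homog_mx0.
  + exact: hphi.
  apply: homog_mxN; case: i => [|i] k l u /=.
    by rewrite ord1 => /(aug_homog resH) ->.
  by move/(dif_homog resH) <-; rewrite addnA.
- move=> k u; rewrite /= /block_deg mxE.
  case: (split k) => k'; first exact: (aug_homog resF).
  by rewrite !mxE ord1 eqxx mulr1n => /hf.
- move=> p; rewrite IJ; split=> [[q /(aug_image resF)[v vE]]|[v]].
    exists (row_mx v q%:M); rewrite [LHS]mul_row_col vE -scalar_mxM.
    by rewrite -raddfD /= subrK.
  rewrite -[v]hsubmxK [X in X = _]mul_row_col => vE.
  exists (rsubmx v 0 0); apply/(aug_image resF); exists (lsubmx v).
  rewrite raddfB /= -vE scalar_mxM -mx11_scalar.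
  by rewrite addrK.
- move=> v; split=> [|[w ->]]; last first.
    rewrite -mulmxA [X in _ *m X]mul_block_col (dif_aug resF) phi0.
    rewrite mul0mx addr0.
    by rewrite mulNmx subrr col_mx0 mulmx0.
  rewrite -[v]hsubmxK; move: (lsubmx v) (rsubmx v) => {}v w.
  rewrite [X in X = _]mul_row_col => vw0.
  (* [w] has a single entry, the coefficient of [f]. *)
  have wE : (- w 0 0 * f)%:M = - (w *m f%:M).
    by rewrite mulNr raddfN /= scalar_mxM -mx11_scalar.
  have /LJ/(aug_image resH)[x xE] : J (- w 0 0 * f).
    apply/(aug_image resF); exists v; apply/eqP.
    by rewrite wE -subr_eq0 opprK vw0.
  have [y yE] : exists y, v - x *m phi 0%N = y *m dif F 0.
    apply/(aug_exact resF); rewrite mulmxBl -mulmxA phi0 mulmxA xE -scalar_mxM.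
    by rewrite wE opprK.
  exists (row_mx y x); rewrite [RHS]mul_row_block mulmx0 add0r mulmxN -yE subrK.
  by rewrite xE raddfN /= opprK -mx11_scalar.
move=> i v; split=> [|[w ->]]; last first.
  rewrite -mulmxA [X in _ *m X]mulmx_block (dif_dif _ resF).
  rewrite !mul0mx !mulmx0 !add0r.
  by rewrite phiS mulNmx subrr mulNmx mulmxN quot_dd !oppr0 block_mx0 mulmx0.
rewrite -[v]hsubmxK; move: (lsubmx v) (rsubmx v) => {}v w.
rewrite [X in X = _]mul_row_block mulmx0 add0r mulmxN -[0]row_mx0.
case/eq_row_mx => vw0 /eqP; rewrite oppr_eq0 => /eqP/quot_exact[x xE].
have [y yE] : exists y, v + x *m phi i.+1 = y *m dif F i.+1.
  by apply/(dif_exact resF); rewrite mulmxDl -mulmxA phiS mulmxA -xE.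
exists (row_mx y (- x)); rewrite [RHS]mul_row_block mulmx0 add0r -yE.
by rewrite mulNmx addrK mulmxN mulNmx opprK -xE.
Qed.

Definition quot_count H d i j : nat :=
  match i with
  | 0 => (d == j)
  | i'.+1 => if (d <= j)%N then deg_count H i' (j - d)%N else 0%N
  end.

Lemma cone_count F H (f : R) d phi i j :
  deg_count (@cone F H f d phi) i j = (deg_count F i j + quot_count H d i j)%N.
Proof.
rewrite /deg_count /= big_split_ord /=; congr (_ + _)%N.
  apply: eq_bigr => k _; rewrite /block_deg.
  by rewrite (_ : split _ = inl k) //; apply: (unsplitK (inl k)).
transitivity (\sum_(k < quot_rk H i) (quot_deg d k == j))%N.
  apply: eq_bigr => k _; rewrite /block_deg.
  by rewrite (_ : split _ = inr k) //; apply: (unsplitK (inr k)).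
case: i => [|i] /=; first by rewrite big_ord1.
case: leqP => [dj|jd].
  by apply: eq_bigr => k _; rewrite -{1}(subnK dj) eqn_add2r.
by apply: big1 => k _; rewrite gtn_eqF // ltn_addl.
Qed.

Lemma deg_count_gt0 F i (k : 'I_(rk F i)) : (0 < deg_count F i (gdeg k))%N.
Proof. by rewrite /deg_count (bigD1 k) //= eqxx. Qed.

Lemma cone_minimal F H (f : R) d phi :
    (forall i, difK F i = 0) -> (forall i, residue (quot_dif H i) = 0) ->
    (forall i, residue (phi i) = 0) ->
  forall i, difK (@cone F H f d phi) i = 0.
Proof.
move=> dF0 dH0 phi0 i; rewrite /difK /= map_block_mx [X in block_mx X]dF0.
rewrite [X in block_mx _ _ X]phi0 map_mxN [X in - X]dH0 oppr0.
by rewrite raddf0 block_mx0.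
Qed.

(** The cone construction as it is used below: the lift [phi] is hidden, and
    minimality is reduced to a comparison of degrees. *)
Lemma mapping_cone F H I J L (f : R) d :
    graded_free_resolution J F -> graded_free_resolution L H ->
    (forall p, L p <-> J (p * f)) ->
    (forall p, I p <-> exists q, J (p - q * f)) ->
    (forall u, u \in msupp f -> mdeg u = d) ->
  exists C, [/\ graded_free_resolution I C,
    forall i j, deg_count C i j = (deg_count F i j + quot_count H d i j)%N
    & (forall i, difK F i = 0) -> (forall i, residue (quot_dif H i) = 0) ->
      (forall i (k : 'I_(rk H i)) (l : 'I_(rk F i)), gdeg k + d != gdeg l)%N ->
      forall i, difK C i = 0].
Proof.
move=> resF resH LJ IJ hf.
have LJ1 p : L p -> J (p * f) by case: (LJ p).
have [phi [hphi phi0 phiS]] := comparison resH resF LJ1 hf.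
exists (cone f d phi); split.
- exact: cone_resolution resF resH LJ IJ hf hphi phi0 phiS.
- exact: cone_count.
move=> dF0 dH0 degHF; apply: cone_minimal => // i.
exact: residue_eq0 (hphi i) (degHF i).
Qed.

Lemma trivial_resolution :
  graded_free_resolution (ideal_gen [::]) (trivial_seq K n).
Proof.
split=> /=; first by move=> i [].
- by case.
- move=> p; rewrite ideal_gen_nil; split=> [->|[v]].
    by exists 0; rewrite mul0mx raddf0.
  by rewrite mulmx0 => /rowP/(_ 0); rewrite !mxE eqxx.
- by move=> v; split=> _; [exists 0; rewrite !thinmx0 | rewrite mulmx0].
- by move=> i v; split=> _; [exists 0; rewrite !thinmx0 | rewrite thinmx0].
Qed.

End MappingCone.

(** * Koszul resolutions of regular sequences *)

Section Koszul.
Import GRing.Theory.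
Local Open Scope ring_scope.
Variables (K : fieldType) (n : nat).
Local Notation R := {mpoly K[n]}.
Variables (a r : nat) (s : seq 'X_{1..n}).
Hypothesis ar_s : ar_sequence K a r s.

Lemma size_monomials : size (monomials K s) = r.
Proof. by case: ar_s => <- _ _; rewrite size_map. Qed.

(** A monomial of degree 0 is 1, but a regular sequence generates a proper
    ideal. *)
Lemma ar_sequence_degree_gt0 : (0 < r)%N -> (0 < a)%N.
Proof.
case: ar_s => sz /allP degs [_ proper] r_gt0; rewrite lt0n; apply/eqP => a0.
have s0 : (0 < size s)%N by rewrite sz.
apply: proper.
have := @mem_ideal_gen _ (monomials K s) 0; rewrite size_map => /(_ s0).
rewrite (nth_map 0%MM) //.
have := degs _ (mem_nth 0%MM s0).
by rewrite a0 mdeg_eq0 => /eqP->; rewrite mpolyX0.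
Qed.

(** Regularity makes each partial ideal its own colon ideal by the next
    element, so the Koszul complex grows by taking the cone over two copies of
    itself; the ranks then follow Pascal's rule. *)
Lemma koszul_resolution :
  exists2 H, graded_free_resolution (ideal_gen (monomials K s)) H &
    forall i j, deg_count H i j = ((a * i.+1 == j) * 'C(r, i.+1))%N.
Proof.
have [sz degs [reg _]] := ar_s.
suff /(_ r): forall t, (t <= r)%N ->
    exists2 H, graded_free_resolution (ideal_gen (take t (monomials K s))) H &
    forall i j, deg_count H i j = ((a * i.+1 == j) * 'C(t, i.+1))%N.
  by rewrite take_oversize ?size_monomials //; apply.
elim=> [_|t IHt lt_t].
  exists (trivial_seq K n); first by rewrite take0; apply: trivial_resolution.
  by move=> i j; rewrite /deg_count /= big_ord0 bin0n muln0.
have [H resH countH] := IHt (ltnW lt_t).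
have lt_tM : (t < size (monomials K s))%N by rewrite size_monomials.
case: (@mapping_cone _ _ H H (ideal_gen (take t.+1 (monomials K s)))
         _ _ (monomials K s)`_t a resH resH).
- by move=> p; split; [apply: ideal_genMr | apply: reg].
- by move=> p; rewrite (take_nth 0) // ideal_gen_rcons.
- have lt_ts : (t < size s)%N by rewrite sz.
  move=> u; rewrite (nth_map 0%MM) // msuppX inE => /eqP->.
  by apply/eqP/(allP degs)/mem_nth.
move=> C [resC countC _]; exists C => // i j.
rewrite countC countH binS mulnDr; congr (_ + _)%N.
case: i => [|i] /=; first by rewrite muln1 bin0 muln1.
rewrite countH [in RHS]mulnS; case: leqP => [aj|ja].
  by rewrite addnC -{2}(subnK aj) eqn_add2r.
by rewrite gtn_eqF // ltn_addr.
Qed.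

(** All generators at place [i] have degree [a * i.+1], and [a] is positive as
    soon as there is a generator, so no map has a constant entry. *)
Lemma koszul_minimal (L : R -> Prop) (H : graded_free_seq K n) :
    graded_free_resolution L H ->
    (forall i j, deg_count H i j = ((a * i.+1 == j) * 'C(r, i.+1))%N) ->
  (forall i (k : 'I_(rk H i)), gdeg k = (a * i.+1)%N /\ (i < r)%N) /\
  (forall i, residue (quot_dif H i) = 0).
Proof.
move=> resH countH.
have degH i (k : 'I_(rk H i)) : gdeg k = (a * i.+1)%N /\ (i < r)%N.
  have := deg_count_gt0 k; rewrite countH muln_gt0 bin_gt0 lt0b.
  by case/andP=> /eqP->.
split=> // -[|i] /=.
  apply: (@residue_eq0 _ _ _ _ (@gdeg _ _ H 0) (fun=> 0%N)).
    by move=> k l u; rewrite ord1 addn0 => /(aug_homog resH).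
  move=> k _; have [-> r_gt0] := degH _ k.
  by rewrite muln1 -lt0n ar_sequence_degree_gt0.
apply: (@residue_eq0 _ _ _ _ (@gdeg _ _ H i.+1) (@gdeg _ _ H i)).
  exact: (@dif_homog _ _ _ _ resH).
move=> k l; have [-> r_gt] := degH _ k; have [-> _] := degH _ l.
rewrite eqn_pmul2l ?gtn_eqF //.
by apply: ar_sequence_degree_gt0; apply: leq_trans r_gt.
Qed.

End Koszul.

(** * Iterated cones over a sequence of monomials *)

Section LinearQuotients.
Import GRing.Theory.
Local Open Scope ring_scope.
Variables (K : fieldType) (n : nat).
Local Notation R := {mpoly K[n]}.

Variables (m : nat) (f : nat -> 'X_{1..n}) (d a r : nat -> nat).
Hypothesis d_def : forall k, (1 <= k <= m)%N -> d k = mdeg (f k).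
Let prefix_ideal k : R -> Prop :=
  ideal_gen (monomials K [seq f l | l <- iota 1 k]).
Hypothesis colon_gen : forall k, (2 <= k <= m)%N ->
  exists2 s, ar_sequence K (a k) (r k) s &
    forall p, colon (prefix_ideal k.-1) 'X_[f k] p
              <-> ideal_gen (monomials K s) p.
Hypotheses (a1 : a 1%N = 0%N) (r1 : r 1%N = 0%N).

(** The convention [a 1 = r 1 = 0] extends the hypothesis on colon ideals to
    [k = 1]: the colon of the zero ideal by [f 1] is zero, generated by the
    empty sequence. *)
Lemma colon_prefix k : (k < m)%N ->
  exists2 s, ar_sequence K (a k.+1) (r k.+1) s &
    forall p, ideal_gen (monomials K s) p <-> prefix_ideal k (p * 'X_[f k.+1]).
Proof.
case: k => [|k] lt_k; last first.
  have [//|s ar_s sP] := colon_gen (k := k.+2).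
  by exists s => // p; rewrite -sP.
exists [::].
  rewrite a1 r1; split=> //; split=> // /ideal_gen_nil/eqP.
  by rewrite oner_eq0.
move=> p; rewrite /prefix_ideal /= !ideal_gen_nil; split=> [->|/eqP].
  by rewrite mul0r.
by rewrite mulf_eq0 -[X in _ || X]msupp_eq0 msuppX orbF => /eqP.
Qed.

(** Each cone contributes one block of generators, and a constant entry out of
    the new block would force one of the coincidences of degrees that the
    condition excludes. *)
Lemma iterated_cone k : (k <= m)%N ->
  exists F, [/\ graded_free_resolution (prefix_ideal k) F,
    forall i j, deg_count F i j =
      (\sum_(l <- iota 1 k) (a l * i + d l == j) * 'C(r l, i))%N
    & (forall k' i,
         2 <= k' <= k -> 1 <= i <= (\max_(2 <= l < k'.+1) r l).+1 ->
         a k' * i + d k'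
           \notin [seq a l * (i - 1) + d l | l <- iota 1 k'.-1])%N ->
      forall i, difK F i = 0].
Proof.
elim: k => [_|k IHk lt_k].
  exists (trivial_seq K n); split.
  - exact: trivial_resolution.
  - by move=> i j; rewrite /deg_count /= big_ord0 big_nil.
  by move=> _ i; rewrite thinmx0.
have [F [resF countF minF]] := IHk (ltnW lt_k).
have [s ar_s colon_s] := colon_prefix lt_k.
have [H resH countH] := koszul_resolution ar_s.
have [degH minH] := koszul_minimal ar_s resH countH.
have iotaS : iota 1 k.+1 = rcons (iota 1 k) k.+1.
  by rewrite -[in LHS](addn1 k) iotaD cats1 add1n.
case: (@mapping_cone _ _ F H (prefix_ideal k.+1) _ _ 'X_[f k.+1] (d k.+1)
         resF resH colon_s).
- move=> p; rewrite /prefix_ideal iotaS /monomials !map_rcons.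
  exact: ideal_gen_rcons.
- by move=> u; rewrite msuppX inE => /eqP->; rewrite d_def.
move=> C [resC countC minC]; exists C; split=> // [i j|cond].
  rewrite countC countF iotaS big_rcons /=; congr (_ + _)%N.
  case: i => [|i] /=; first by rewrite muln0 bin0 muln1.
  rewrite countH; case: leqP => [dj|jd].
    by rewrite -{2}(subnK dj) eqn_add2r.
  by rewrite gtn_eqF // ltn_addl.
apply: minC => //.
  by apply: minF => k' i /andP[k2 kk]; apply: cond; rewrite k2 ltnW.
move=> i x y; have [-> lt_ir] := degH _ x.
have := deg_count_gt0 y; rewrite countF lt0n sum_nat_seq_neq0 => /hasP[l l_in].
rewrite muln_eq0 negb_or eqb0 negbK /= => /andP[/eqP <- _].
have k_gt0 : (0 < k)%N by move: l_in; case: (k).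
have k_le : (2 <= k.+1 <= k.+1)%N by rewrite ltnS k_gt0 leqnn.
have i_le : (1 <= i.+1 <= (\max_(2 <= l < k.+2) r l).+1)%N.
  by apply: (leq_trans lt_ir); rewrite big_nat_recr //= leqW // leq_maxr.
have := cond _ _ k_le i_le; rewrite subn1 /=; apply: contraNneq => ->.
exact: map_f.
Qed.

End LinearQuotients.

(** The case distinction of [betti_bound] is only apparent: for [j] outside
    [Aset m a d i] the sum is empty. *)
Lemma betti_boundE m a d r i j :
  betti_bound m a d r i j =
  \sum_(l <- iota 1 m) (a l * i + d l == j) * 'C(r l, i).
Proof.
have sumE : \sum_(l <- iota 1 m) (a l * i + d l == j) * 'C(r l, i) =
    \sum_(k <- Kset m a d i j) 'C(r k, i).
  rewrite big_filter [RHS]big_mkcond; apply: eq_bigr => l _.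
  by case: eqP; rewrite ?mul1n ?mul0n.
rewrite /betti_bound sumE; case: ifPn => // /mapP jA.
rewrite -sumE big_seq big1 // => l l_in; case: eqP => // jE.
by case: jA; exists l => //; rewrite mulnC.
Qed.

Theorem theorem2p7 (K : fieldType) (n m : nat) (f : nat -> 'X_{1..n})
    (d a r : nat -> nat) (I : {mpoly K[n]} -> Prop)
    (m_gt0 : 0 < m)
    (I_gen : forall p,
       I p <-> ideal_gen (monomials K [seq f k | k <- iota 1 m]) p)
    (d_def : forall k, 1 <= k <= m -> d k = mdeg (f k))
    (colon_gen : forall k, 2 <= k <= m ->
       exists2 s : seq 'X_{1..n}, ar_sequence K (a k) (r k) s &
         forall p, colon (ideal_gen (monomials K [seq f l | l <- iota 1 k.-1]))
                         'X_[f k] p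
                   <-> ideal_gen (monomials K s) p)
    (a1 : a 1 = 0) (r1 : r 1 = 0) :
  (forall i j, betti I i j <= betti_bound m a d r i j) /\
  ((forall k i, 2 <= k <= m -> 1 <= i <= (\max_(2 <= l < k.+1) r l).+1 ->
      a k * i + d k \notin [seq a l * (i - 1) + d l | l <- iota 1 k.-1]) ->
   forall i j, betti I i j = betti_bound m a d r i j).
Proof.
have [F [resF countF minF]] := iterated_cone d_def colon_gen a1 r1 (leqnn m).
have resI : graded_free_resolution I F.
  by case: resF => ? ? img ? ?; split=> // p; rewrite I_gen img.
split=> [i j|cond i j]; rewrite (betti_tor_dim i j resI) betti_boundE -countF.
  exact: tor_dim_le_count.
by rewrite tor_dim_minimal //; apply: minF.
Qed.
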